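(* There exists an absolute constant $K$ such that the following holds. Let $\mathcal F$ be a locally finite covering of the plane $\mathbb R^2$ by closed unit discs, let $A,B\in\mathbb R^2$ be two points contained in the doubly covered region of $\mathbb R^2$ by $\mathcal F$, and let $d=\lvert AB\rvert$ be the Euclidean distance between them. Then the shortest path $\gamma$ joining $A$ and $B$ that is completely contained in the doubly covered region has length $$\lvert\gamma\rvert\le\left(\frac{\pi}{3}+\sqrt 3\right)d+K;$$ that is, $A$ and $B$ can be joined by a path of at most this length contained in the doubly covered region.
   Context: A closed unit disc is a closed disc of radius $1$ in the Euclidean plane. A covering $\mathcal F$ of $\mathbb R^2$ by closed unit discs is a family of (distinct) closed unit discs whose union is $\mathbb R^2$; it is locally finite if every bounded subset of the plane meets only finitely many members of $\mathcal F$. The doubly covered region of $\mathbb R^2$ by $\mathcal F$ is the set of points $x\in\mathbb R^2$ that are contained in at least two elements of $\mathcal F$. For a path $\gamma$, $\lvert\gamma\rvert$ denotes its length. *)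

(* Defs.v *)
From HB Require Import structures.
From mathcomp Require Import all_boot all_order all_algebra.
From mathcomp Require Import all_classical all_reals all_analysis.

Set Implicit Arguments.
Unset Strict Implicit.
Unset Printing Implicit Defensive.

Import Order.TTheory GRing.Theory Num.Theory.
Import numFieldTopology.Exports numFieldNormedType.Exports.

Local Open Scope classical_set_scope.
Local Open Scope ring_scope.

(* The plane is R * R.  The library norm on R * R is the sup norm, hence a
   separate Euclidean distance; both give the same topology and the same
   bounded sets, so continuity and boundedness are the library's. *)
Definition eucl_dist (R : realType) (x y : R * R) : R :=
  Num.sqrt ((x.1 - y.1) ^+ 2 + (x.2 - y.2) ^+ 2).

Definition unit_disc (R : realType) (c : R * R) : set (R * R) :=
  [set x | eucl_dist c x <= 1].

(* A family of discs is a set of subsets of the plane, so that its members are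
   automatically distinct. *)
Definition disc_covering (R : realType) (F : set (set (R * R))) : Prop :=
  F `<=` range (@unit_disc R) /\ \bigcup_(D in F) D = setT.

Definition loc_finite (R : realType) (F : set (set (R * R))) : Prop :=
  forall S : set (R * R), bounded_set S ->
    finite_set [set D | F D /\ D `&` S !=set0].

Definition doubly_covered (R : realType) (F : set (set (R * R))) :
    set (R * R) :=
  [set x | exists D1 D2, [/\ F D1, F D2, D1 <> D2, D1 x & D2 x]].

(* Only the restriction of gamma to [0, 1] matters. *)
Definition path_in (R : realType) (U : set (R * R)) (A B : R * R)
    (gamma : R -> R * R) : Prop :=
  [/\ {within `[0, 1], continuous gamma}, gamma 0 = A, gamma 1 = B &
      gamma @` `[0, 1] `<=` U].

(* As for the library's [itv_partition], the subdivision is 0 :: s with s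
   strictly increasing and ending at 1. *)
Definition polygonal_length (R : realType) (gamma : R -> R * R) (s : seq R) :
    R :=
  let p := nth 1 (0 :: s) in
  \sum_(0 <= i < size s) eucl_dist (gamma (p i)) (gamma (p i.+1)).

Definition path_length (R : realType) (gamma : R -> R * R) : \bar R :=
  ereal_sup [set (polygonal_length gamma s)%:E | s in itv_partition 0 1].

(* Main.v *)
Require Import Defs.
From mathcomp Require Import all_boot all_order all_algebra.
From mathcomp Require Import all_classical all_reals all_analysis.
From mathcomp Require Import ring lra.

Set Implicit Arguments.
Unset Strict Implicit.
Unset Printing Implicit Defensive.

Import Order.TTheory GRing.Theory Num.Theory.
Import numFieldTopology.Exports numFieldNormedType.Exports.

Local Open Scope classical_set_scope.
Local Open Scope ring_scope.

(** Circles and lenses are doubly covered.  The boundary circle of a disc D of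
    the covering consists of limits of points outside D, and those points lie
    in other discs, only finitely many of which come near; so every point of
    the circle lies in a second disc ([circle_doubly_covered]).  The
    intersection of two discs of the covering is doubly covered by definition.

    From a chain of centres to a path.  Let c_0, ..., c_n be centres with
    consecutive ones at distance at most 2 and with c_i, c_(i+2) at distance
    more than 2.  The circles around c_i and c_(i+1) meet at the left and the
    right vertex of a lens.  Walking along the circles from left vertex to left
    vertex is one route through the doubly covered region, from right vertex to
    right vertex another.  On the circle around c_i, the arcs of the two routes
    are what remains after removing the arcs inside the two neighbouring discs;
    the discs around c_(i-1) and c_(i+1) being disjoint, nothing is removed
    twice, and with s, s' the distances to the neighbours what remains has
    total length 2 asin (s / 2) + 2 asin (s' / 2) <= (pi / 2) (s + s')
    ([arcs_around]).  Adding up, the shorter of the two routes is at most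
    pi / 2 times the length of the chain ([two_routes]).  A chain whose centres
    c_i, c_(i+2) are too close gets shorter by skipping c_(i+1)
    ([chain_connected_hop]).

    Short chains.  To go from a centre c towards a centre b, slide a unit disc
    from c in the direction of b until the last centre c1 at distance at most 2
    from c is about to leave it.  As the slightly advanced disc still contains
    a centre, there is a centre c2 in the disc at distance at least 2 from c
    ([sliding_disc]).  Either the hop from c to c1 or the two hops from c
    through c1 to c2 have length at most 1.7 times the progress in the
    direction of b ([one_or_two_hops]).  The sideways displacement is at most
    1, which far away from b hardly matters, so that the ratio of the length of
    the chain to the decrease of the distance to b is at most 1.74
    ([greedy_step]); near b the number of steps is bounded ([near_chain]).

    Altogether the path has length at most (pi / 2) 1.74 d + O(1), and
    (pi / 2) 1.74 <= pi / 3 + sqrt 3 because pi <= 3.2. *)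

(** * The Euclidean distance *)

Section EuclideanDistance.
Context {R : realType}.
Implicit Types (x y z : R * R) (r : R).

Lemma eucl_dist_ge0 x y : 0 <= eucl_dist x y.
Proof. exact: sqrtr_ge0. Qed.

Lemma eucl_distC x y : eucl_dist x y = eucl_dist y x.
Proof. by rewrite /eucl_dist; congr (Num.sqrt _); ring. Qed.

Lemma sqr_eucl_dist x y :
  eucl_dist x y ^+ 2 = (x.1 - y.1) ^+ 2 + (x.2 - y.2) ^+ 2.
Proof. by rewrite sqr_sqrtr// addr_ge0// sqr_ge0. Qed.

Lemma eucl_distxx x : eucl_dist x x = 0.
Proof. by rewrite /eucl_dist !subrr expr0n/= addr0 sqrtr0. Qed.

Lemma eucl_dist_le x y r : 0 <= r ->
  (eucl_dist x y <= r) = ((x.1 - y.1) ^+ 2 + (x.2 - y.2) ^+ 2 <= r ^+ 2).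
Proof. by move=> r0; rewrite -sqr_eucl_dist ler_sqr ?nnegrE// eucl_dist_ge0. Qed.

Lemma eucl_dist_lt x y r : 0 <= r ->
  (r < eucl_dist x y) = (r ^+ 2 < (x.1 - y.1) ^+ 2 + (x.2 - y.2) ^+ 2).
Proof. by move=> r0; rewrite !ltNge eucl_dist_le. Qed.

Lemma eucl_dist_eq0 x y : eucl_dist x y = 0 -> x = y.
Proof.
move=> xy0; have := sqr_eucl_dist x y; rewrite xy0 expr0n/= => /esym/eqP.
rewrite paddr_eq0 ?sqr_ge0// !sqrf_eq0 !subr_eq0 => /andP[/eqP e1 /eqP e2].
by case: x y e1 e2 {xy0} => ? ? [? ?] /= -> ->.
Qed.

Lemma eucl_dist_triangle y x z :
  eucl_dist x z <= eucl_dist x y + eucl_dist y z.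
Proof.
have h1 := eucl_dist_ge0 x y; have h2 := eucl_dist_ge0 y z.
have e1 := sqr_eucl_dist x y; have e2 := sqr_eucl_dist y z.
rewrite eucl_dist_le ?addr_ge0//.
move: (eucl_dist x y) (eucl_dist y z) h1 h2 e1 e2 => u v u0 v0.
set a := x.1 - y.1; set b := x.2 - y.2; set c := y.1 - z.1; set d := y.2 - z.2.
move=> e1 e2.
have -> : x.1 - z.1 = a + c by rewrite /a /c; ring.
have -> : x.2 - z.2 = b + d by rewrite /b /d; ring.
have cs : a * c + b * d <= u * v.
  have [//|lt0] := lerP (a * c + b * d) 0; first by move/le_trans; apply; exact: mulr_ge0.
  rewrite -(@ler_pXn2r _ 2)// ?nnegrE ?mulr_ge0 ?(ltW lt0)//.
  by rewrite exprMn e1 e2; have := sqr_ge0 (a * d - b * c); nra.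
nra.
Qed.

Lemma norm_le_eucl_dist x y : `|x - y| <= eucl_dist x y.
Proof.
rewrite prod_normE ge_max /= -!sqrtr_sqr !ler_wsqrtr//.
  by rewrite lerDr sqr_ge0.
by rewrite lerDl sqr_ge0.
Qed.

End EuclideanDistance.

(** * Paths with a Lipschitz parametrization *)

Section LipschitzPaths.
Context {R : realType}.
Implicit Types (U : set (R * R)) (A B C : R * R) (l : R).

(** Lengths of 1-Lipschitz paths add up under concatenation without any talk of
    subdivisions, and a 1-Lipschitz path on [0, l] has length at most l; the
    subdivisions of [path_length] are dealt with once, in
    [arclength_path_path]. *)
Definition arclength_path U A B l : Prop :=
  0 <= l /\ exists g : R -> R * R,
    [/\ g 0 = A, g l = B,
        forall t, 0 <= t <= l -> U (g t) &
        forall s t, 0 <= s -> s <= t -> t <= l -> eucl_dist (g s) (g t) <= t - s].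

Lemma arclength_path_refl U A : U A -> arclength_path U A A 0.
Proof.
move=> UA; split=> //; exists (fun=> A); split=> // s t _ st _.
by rewrite eucl_distxx subr_ge0.
Qed.

Lemma arclength_path_sym U A B l :
  arclength_path U A B l -> arclength_path U B A l.
Proof.
move=> [l0 [g [gA gB gU glip]]]; split=> //; exists (fun t => g (l - t)); split.
- by rewrite subr0.
- by rewrite subrr.
- by move=> t /andP[t0 tl]; apply: gU; lra.
- move=> s t s0 st tl; rewrite eucl_distC.
  by apply: le_trans (glip (l - t) (l - s) _ _ _) _; lra.
Qed.

Lemma arclength_path_trans U A B C l1 l2 :
  arclength_path U A B l1 -> arclength_path U B C l2 ->
  arclength_path U A C (l1 + l2).
Proof.
move=> [l10 [g [gA gB gU glip]]] [l20 [h [hB hC hU hlip]]].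
split; first exact: addr_ge0.
exists (fun t => if t <= l1 then g t else h (t - l1)); split.
- by rewrite l10.
  (* the final time l1 + l2 falls into the first half only when l2 = 0 *)
- case: ifPn => [le|]; last by rewrite addrAC subrr add0r.
  have l2E : l2 = 0 by lra.
  by rewrite l2E addr0 gB -hB -hC l2E.
- move=> t /andP[t0 tl]; case: ifPn => [tl1|]; first by apply: gU; lra.
  by rewrite -ltNge => tl1; apply: hU; lra.
- move=> s t s0 st tl; case: (lerP t l1) => tl1.
    by rewrite (le_trans st tl1); apply: glip.
  case: (lerP s l1) => sl1.
    apply: le_trans (eucl_dist_triangle B _ _) _.
    have := glip s l1 s0 sl1 (lexx _); rewrite gB.
    have := hlip 0 (t - l1) (lexx _); rewrite hB.
    by move=> /(_ _ _)/[swap] gs hs; have := hs; lra.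
  by apply: le_trans (hlip (s - l1) (t - l1) _ _ _) _; lra.
Qed.

(** Rescaled to [0, 1] the path is l-Lipschitz, so the length of an inscribed
    polygon is bounded by a telescoping sum. *)
Lemma arclength_path_path U A B l : arclength_path U A B l ->
  exists gamma, path_in U A B gamma /\ (path_length gamma <= l%:E)%E.
Proof.
move=> [l0 [g [gA gB gU glip]]].
have lip s t : 0 <= s <= 1 -> 0 <= t <= 1 ->
    eucl_dist (g (s * l)) (g (t * l)) <= l * `|t - s|.
  wlog st : s t / s <= t.
    move=> wl hs ht; case: (leP s t) => [st|/ltW ts]; first exact: wl.
    by rewrite eucl_distC distrC; exact: wl.
  move=> /andP[s0 s1] /andP[t0 t1]; rewrite ger0_norm ?subr_ge0//.
  apply: le_trans (glip _ _ _ _ _) _; nra.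
exists (fun t => g (t * l)); split; last first.
  apply: ge_ereal_sup => _ [s [sorted_s /eqP last_s] <-]; rewrite lee_fin.
  rewrite /polygonal_length; set p := nth 1 (0 :: s).
  have p_lt i : (i < size s)%N -> p i < p i.+1.
    by move=> i_s; have /(pathP 1)/(_ i i_s) := sorted_s.
  have p_last : p (size s) = 1.
    by rewrite /p -[RHS]last_s (last_nth 1).
  have p_ge0 i : (i <= size s)%N -> 0 <= p i.
    elim: i => [//|i IH] i_s.
    by rewrite (le_trans (IH (ltnW i_s)))// ltW// p_lt.
  have p_le1 j i : (i + j = size s)%N -> p i <= 1.
    elim: j i => [|j IH] i; first by rewrite addn0 => ->; rewrite p_last.
    move=> e; rewrite (le_trans (ltW (p_lt i _)))//.
      by rewrite -e addnS ltnS leq_addr.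
    by apply: IH; rewrite addSn -e addnS.
  have p_in i : (i <= size s)%N -> 0 <= p i <= 1.
    by move=> i_s; rewrite p_ge0//= (p_le1 (size s - i)%N)// subnKC.
  have : \sum_(0 <= i < size s) eucl_dist (g (p i * l)) (g (p i.+1 * l)) <=
         \sum_(0 <= i < size s) (l * p i.+1 - l * p i).
    rewrite big_nat_cond [leRHS]big_nat_cond; apply: ler_sum => i.
    rewrite andbT => /andP[_ i_s].
    apply: le_trans (lip _ _ (p_in _ (ltnW i_s)) (p_in _ i_s)) _.
    by rewrite gtr0_norm ?subr_gt0 ?p_lt// mulrBr.
  move/le_trans; apply; rewrite (telescope_sumr (fun i => l * p i))//.
  by rewrite p_last /p /=; lra.
split.
- apply/subspace_continuousP => t /= /[!in_itv]/= t01.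
  apply/cvgrPdist_le => e e0.
  have l1 : 0 < l + 1 by lra.
  rewrite near_withinE; apply/nbhs_ballP; exists (e / (l + 1)).
    by rewrite /= divr_gt0.
  move=> u /=; rewrite /ball/= in_itv/= distrC => /ltW tu u01.
  have : eucl_dist (g (t * l)) (g (u * l)) <= e.
    apply: le_trans (lip _ _ t01 u01) _.
    by move: tu; rewrite ler_pdivlMr//; have := normr_ge0 (u - t); nra.
  apply: le_trans; exact: norm_le_eucl_dist.
- by rewrite mul0r.
- by rewrite mul1r.
- by move=> _ [t /= /[!in_itv]/= /andP[t0 t1] <-]; apply: gU; nra.
Qed.

End LipschitzPaths.

(** * Trigonometric inequalities *)

Section Trigonometry.
Context {R : realType}.
Implicit Types x y t : R.

Lemma norm_sin_le x : `|sin x| <= `|x|.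
Proof.
wlog x0 : x / 0 <= x.
  move=> wl; case: (leP 0 x) => [/wl//|x0].
  by rewrite -normrN -sinN -[leRHS]normrN; apply: wl; lra.
have [|c _] := @MVT_segment R sin cos 0 x x0 (fun y _ => is_derive_sin y).
  by apply/continuous_subspaceT => ?; exact: continuous_sin.
rewrite sin0 !subr0 => ->; rewrite normrM; have := cos_max c.
by have := normr_ge0 x; nra.
Qed.

Lemma cos_ge_quadratic x : 1 - x ^+ 2 / 2 <= cos x.
Proof.
have -> : cos x = 1 - 2 * sin (x / 2) ^+ 2.
  rewrite [in LHS](_ : x = (x / 2) *+ 2); last by rewrite mulr2n; lra.
  by rewrite cos_mulr2n cos2sin2 mulr2n; ring.
have : sin (x / 2) ^+ 2 <= (x / 2) ^+ 2.
  by rewrite -[leLHS]real_normK ?num_real// -[leRHS]real_normK ?num_real//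
             ler_sqr ?nnegrE// norm_sin_le.
by nra.
Qed.

Lemma sin_ge_cubic x : 0 <= x -> x - x ^+ 3 / 6 <= sin x.
Proof.
move=> x0; pose f y : R := sin y - y + y ^+ 3 / 6.
have df y : is_derive y 1 f (cos y - 1 + y ^+ 2 / 2).
  apply: is_deriveD => //.
  apply: is_derive_eq.
  rewrite /GRing.scale/= !mulr1; lra.
have [|c _] := @MVT_segment R f _ 0 x x0 (fun y _ => df y).
  by apply/derivable_within_continuous => y _; have [] := df y.
rewrite /f sin0 !expr0n /= mul0r; have := cos_ge_quadratic c; nra.
Qed.

(** If pi / 4 > 4 / 5, the cubic lower bound for the sine at pi / 4 exceeds the
    square root of 1 / 2, which is the value of the sine there. *)
Lemma pi_le_16_5 : pi <= 16 / 5 :> R.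
Proof.
rewrite leNgt; apply/negP => pi_gt; have pi_lt := @pihalf_lt2 R.
have s2 : sin (pi / 4) ^+ 2 = 1 / 2 :> R.
  have := cos_mulr2n (pi / 4 : R).
  rewrite (_ : (pi / 4) *+ 2 = pi / 2 :> R); last by rewrite mulr2n; lra.
  rewrite cos_pihalf cos2sin2 mulr2n; lra.
have := @sin_ge_cubic (pi / 4); set x := pi / 4 in s2 *.
have x1 : 4 / 5 < x by rewrite /x; lra.
have x2 : x < 1 by rewrite /x; lra.
have : 714 / 1000 < x - x ^+ 3 / 6.
  (* the difference of the values of the cubic at x and at 4 / 5, times 6 *)
  have : 0 <= (x - 4 / 5) * (6 - (x ^+ 2 + 4 / 5 * x + 16 / 25)).
    by apply: mulr_ge0; nra.
  by nra.
move: s2; set s := sin x; set u := x - _ => s2 hu /(_ (ltW _)); nra.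
Qed.

(** The chord of the concave function cos on [0, pi/2] lies below its graph. *)
Lemma cos_ge_chord x : 0 <= x -> x <= pi / 2 -> 1 - 2 / pi * x <= cos x.
Proof.
move=> x0 xpi; have pi0 := @pi_gt0 R.
pose f y : R := cos y + 2 / pi * y.
have df y : is_derive y 1 f (- sin y + 2 / pi).
  apply: is_deriveD => //.
  apply: is_derive_eq.
  rewrite /GRing.scale/= mulr1; lra.
have cf (i : interval R) : {within [set` i], continuous f}.
  by apply: derivable_within_continuous => y _; have [] := df y.
have f0 : f 0 = 1 by rewrite /f cos0 mulr0 addr0.
have fpi : f (pi / 2) = 1.
  by rewrite /f cos_pihalf add0r -invf_div mulVf// lt0r_neq0// divr_gt0.
rewrite leNgt; apply/negP => fx_lt; have {}fx_lt : f x < 1 by rewrite /f; lra.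
(* a value below the chord would force the derivative to increase *)
have xn0 : 0 < x by rewrite lt0r x0 andbT; apply: contraTneq fx_lt => ->; rewrite f0 ltxx.
have xnpi : x < pi / 2.
  by rewrite lt_neqAle xpi andbT; apply: contraTneq fx_lt => ->; rewrite fpi ltxx.
have [c1 /[!in_itv]/= /andP[c10 c1x]] := MVT xn0 (fun y _ => df y) (cf _).
rewrite f0 subr0 => e1.
have [c2 /[!in_itv]/= /andP[c2x c2pi]] := MVT xnpi (fun y _ => df y) (cf _).
rewrite fpi => e2.
have : sin c1 < sin c2.
  by rewrite ltr_sin ?in_itv/=; lra.
have : - sin c1 + 2 / pi < 0 by rewrite -(pmulr_llt0 _ xn0) -e1; lra.
have xpi0 : 0 < pi / 2 - x by lra.
have : 0 < - sin c2 + 2 / pi by rewrite -(pmulr_lgt0 _ xpi0) -e2; lra.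
lra.
Qed.

Lemma polar_angle x y r : 0 < r -> x ^+ 2 + y ^+ 2 = r ^+ 2 ->
  exists phi, [/\ - pi <= phi, phi <= pi, x = r * cos phi & y = r * sin phi].
Proof.
move=> r0 xyr; have pi0 := @pi_ge0 R.
wlog y0 : y xyr / 0 <= y.
  move=> wl; case: (leP 0 y) => [/wl|y0]; first exact.
  have [||phi [h1 h2 h3 h4]] := wl (- y); [by rewrite sqrrN|lra|].
  exists (- phi); rewrite cosN sinN; split; lra.
have xr : -1 <= x / r <= 1.
  by rewrite -ler_norml normrM normfV (gtr0_norm r0) ler_pdivrMr// mul1r
    -[leRHS]ger0_norm ?(ltW r0)// -ler_sqr ?nnegrE// !real_normK ?num_real//; nra.
exists (acos (x / r)); split.
- by apply: le_trans (acos_ge0 xr); lra.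
- exact: acos_lepi.
- by rewrite acosK ?in_itv//=; field; rewrite gt_eqF.
- have rn0 : r != 0 by exact: lt0r_neq0.
  have e : 1 - (x / r) ^+ 2 = (y / r) ^+ 2.
    have : (y ^+ 2 + x ^+ 2) / r ^+ 2 = 1 by rewrite addrC xyr divff// expf_neq0.
    by rewrite !expr_div_n mulrDl; lra.
  rewrite sin_acos// e sqrtr_sqr ger0_norm ?divr_ge0// ?ltW//.
  by rewrite mulrC divfK.
Qed.

End Trigonometry.

(** * Chains of intersecting discs *)

Section Chains.
Context {R : realType}.
Implicit Types (C : set (R * R)) (b c : R * R) (s : seq (R * R)) (l : R).

Fixpoint chain_length c s : R :=
  if s is c1 :: s1 then eucl_dist c c1 + chain_length c1 s1 else 0.

(** The consecutive centres carry intersecting discs, and the discs two steps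
    apart are disjoint. *)
Fixpoint taut_chain C c s : Prop :=
  if s is c1 :: s1 then
    [/\ C c1, c <> c1, eucl_dist c c1 <= 2,
        (if s1 is c2 :: _ then 2 < eucl_dist c c2 else True) &
        taut_chain C c1 s1]
  else True.

Definition chain_connected C c b l : Prop :=
  exists s, [/\ taut_chain C c s, last c s = b & chain_length c s <= l].

Lemma chain_connected_refl C c : chain_connected C c c 0.
Proof. by exists [::]; split. Qed.

Lemma chain_connectedW C c b l l' :
  l <= l' -> chain_connected C c b l -> chain_connected C c b l'.
Proof. by move=> ll' [s [? ? /le_trans sl]]; exists s; split => //; exact: sl. Qed.

(** If the new first centre is within reach of the second centre of the old
    chain, the first one is skipped, which by the triangle inequality does not
    lengthen the chain; this may happen repeatedly. *)
Lemma chain_connected_hop C c c1 b l : C c1 -> eucl_dist c c1 <= 2 ->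
  chain_connected C c1 b l -> chain_connected C c b (eucl_dist c c1 + l).
Proof.
move=> Cc1 cc1 [s [s_taut s_last s_len]].
elim: s c1 l s_taut s_last s_len Cc1 cc1 =>
  [|c2 s IH] c1 l /= s_taut s_last s_len Cc1 cc1.
  have [->|/eqP cc1_neq] := eqVneq c c1.
    by rewrite eucl_distxx add0r; exists [::]; split.
  by exists [:: c1]; split => //=; rewrite lerD2l.
have [->|/eqP cc1_neq] := eqVneq c c1.
  by rewrite eucl_distxx add0r; exists (c2 :: s); split.
have [cc2|cc2] := leP (eucl_dist c c2) 2; last first.
  by exists [:: c1, c2 & s]; split => //=; rewrite lerD2l.
case: s_taut => Cc2 _ _ _ s_taut.
apply: chain_connectedW (IH c2 _ s_taut s_last (lexx _) Cc2 cc2).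
by have := eucl_dist_triangle c1 c c2; lra.
Qed.

End Chains.

(** * Locally finite coverings *)

Section LargestElement.
Context {R : realType} {T : choiceType}.

Lemma finite_set_argmax (S : set T) (f : T -> R) x0 : finite_set S -> S x0 ->
  exists2 x, S x & forall y, S y -> f y <= f x.
Proof.
move=> /finite_seqP[s ->] /= x0s.
have [m ms mmax] : exists2 m, m \in s & {in s, forall y, f y <= f m}.
  elim: s x0 x0s => [//|a s IH] x0 _.
  case: s IH => [_|a' s IH]; first by exists a; rewrite ?mem_head// => y /[1!inE] /eqP->.
  have [m ms mmax] := IH a' (mem_head _ _).
  have [am|ma] := leP (f a) (f m).
    exists m; first by rewrite inE ms orbT.
    by move=> y /[1!inE] /predU1P[->//|/mmax].
  exists a; first exact: mem_head.
  by move=> y /[1!inE] /predU1P[->//|/mmax/le_trans]; apply; exact: ltW.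
by exists m.
Qed.

End LargestElement.

Section Covering.
Context {R : realType} (F : set (set (R * R))).
Hypotheses (F_cov : disc_covering F) (F_fin : loc_finite F).
Implicit Types (b c p q u x : R * R) (r t : R).

Definition centres : set (R * R) := [set c | F (unit_disc c)].

(** The point of the disc around p that is farthest from q is not in the disc
    around q. *)
Lemma unit_disc_inj : injective (@unit_disc R).
Proof.
move=> p q pq; apply/eqP; apply: contraPT isT => /eqP pq_neq _.
pose s := eucl_dist p q; have s0 : 0 < s.
  by rewrite lt0r eucl_dist_ge0 andbT; apply/eqP => /eucl_dist_eq0.
have sE := sqr_eucl_dist p q; rewrite -/s in sE.
pose z : R * R := (p.1 + (p.1 - q.1) / s, p.2 + (p.2 - q.2) / s).
have : unit_disc p z.
  rewrite /unit_disc/= eucl_dist_le// /z/=.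
  rewrite (_ : _ + _ = ((p.1 - q.1) ^+ 2 + (p.2 - q.2) ^+ 2) / s ^+ 2).
    by rewrite -sE divff ?expf_neq0 ?lt0r_neq0// expr1n.
  by field; exact: lt0r_neq0.
rewrite pq /unit_disc/= leNgt eucl_dist_lt// => /negP; apply.
rewrite /z/= (_ : _ + _ = ((p.1 - q.1) ^+ 2 + (p.2 - q.2) ^+ 2) * (1 + s^-1) ^+ 2).
  by rewrite -sE -exprMn mulrDr mulr1 divff ?lt0r_neq0//; nra.
by field; exact: lt0r_neq0.
Qed.

Lemma covered p : exists2 q, centres q & eucl_dist q p <= 1.
Proof.
have : (\bigcup_(D in F) D) p by rewrite F_cov.2.
move=> [D FD Dp]; have [q _ qD] := F_cov.1 D FD.
by exists q; [rewrite /centres/= qD|rewrite -qD in Dp].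
Qed.

Lemma finite_centres p r :
  finite_set [set q | centres q /\ eucl_dist q p <= r].
Proof.
pose S := [set x | eucl_dist x p <= r + 1].
have Sbnd : bounded_set S.
  exists (`|p| + r + 1); split; first exact: num_real.
  move=> M hM x /= xS; have {}xS : eucl_dist x p <= r + 1 by [].
  rewrite -[x](subrK p).
  apply: le_trans (ler_normD _ _) _.
  by have := norm_le_eucl_dist x p; lra.
have fin := F_fin Sbnd.
apply: sub_finite_set (finite_preimage _ fin) => [q [Cq qp]|]; last first.
  by move=> q q' _ _; exact: unit_disc_inj.
split=> //; exists q; split; rewrite /unit_disc /S /=; last lra.
by rewrite eucl_distxx.
Qed.

(** Among the finitely many centres near p that are at distance more than 1,
    one is nearest. *)
Lemma centres_gap p : exists2 e, 0 < e &
  forall q, centres q -> eucl_dist q p <= 1 + e -> eucl_dist q p <= 1.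
Proof.
pose S := [set q | centres q /\ eucl_dist q p <= 2] `&` [set q | 1 < eucl_dist q p].
have Sfin : finite_set S by apply: finite_setIl; exact: finite_centres.
have [[q0 Sq0]|S0] := pselect (S !=set0).
  have [m Sm mmin] := finite_set_argmax (fun q => - eucl_dist q p) Sfin Sq0.
  case: (Sm) => [[_ m2] /= m1].
  exists ((eucl_dist m p - 1) / 2); first by lra.
  move=> q Cq qp; rewrite leNgt; apply/negP => q1.
  have Sq : S q by do 2 (split => //=); lra.
  by have := mmin q Sq; lra.
exists 1 => // q Cq qp; rewrite leNgt; apply/negP => q1; apply: S0.
by exists q; do 2 (split => //=).
Qed.

(** A point slightly outside the disc, beyond x, is covered by another disc,
    and by [centres_gap] that disc contains x as well. *)
Lemma circle_doubly_covered c x :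
  centres c -> eucl_dist c x = 1 -> doubly_covered F x.
Proof.
move=> Cc cx1.
have [e e0 gap] := centres_gap x.
pose z : R * R := (x.1 + e * (x.1 - c.1), x.2 + e * (x.2 - c.2)).
have cxE := sqr_eucl_dist c x; rewrite cx1 in cxE.
have xz : eucl_dist z x <= e.
  rewrite eucl_dist_le ?(ltW e0)// /z/=.
  rewrite (_ : _ + _ = e ^+ 2 * ((c.1 - x.1) ^+ 2 + (c.2 - x.2) ^+ 2)); last ring.
  by rewrite -cxE expr1n mulr1 lexx.
have cz : 1 < eucl_dist c z.
  rewrite eucl_dist_lt// /z/=.
  rewrite (_ : _ + _ = (1 + e) ^+ 2 * ((c.1 - x.1) ^+ 2 + (c.2 - x.2) ^+ 2)); last ring.
  by rewrite -cxE expr1n mulr1; nra.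
have [q Cq qz] := covered z.
have qx : eucl_dist q x <= 1.
  by apply: gap => //; apply: le_trans (eucl_dist_triangle z _ _) _; lra.
exists (unit_disc c), (unit_disc q); split=> //; last by rewrite /unit_disc/= cx1.
by move=> /unit_disc_inj cq; rewrite cq in cz; lra.
Qed.

Lemma lens_doubly_covered c c' x : centres c -> centres c' -> c <> c' ->
  eucl_dist c x <= 1 -> eucl_dist c' x <= 1 -> doubly_covered F x.
Proof.
move=> Cc Cc' cc' cx c'x; exists (unit_disc c), (unit_disc c'); split => //.
by move/unit_disc_inj.
Qed.

End Covering.

(** * Greedy chains of centres *)

Section HopEstimate.
Context {R : realType}.

(** The first centre is at the origin and the target in the direction of the
    positive first axis.  The disc of radius 1 around (t, 0) has (t - w, y) on
    the left half of its boundary, at distance s from the origin, and contains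
    (X, Y).  The second hop is bounded by the diameter 2 of the disc.  If the
    single hop is too long for its progress t - w, then y is large compared
    with t - w; this forces t close to 1, where X is close to 2 and s is not
    much larger than 1.  Requiring t - w >= 1 / 4 as well makes the progress of
    the single hop bounded from below. *)
Lemma one_or_two_hops (t w y s X Y : R) : 1 <= t -> 0 <= w ->
  w ^+ 2 + y ^+ 2 = 1 -> 0 <= s -> s ^+ 2 = (t - w) ^+ 2 + y ^+ 2 ->
  (X - t) ^+ 2 + Y ^+ 2 <= 1 -> 4 <= X ^+ 2 + Y ^+ 2 ->
  (s <= 17 / 10 * (t - w) /\ 1 / 4 <= t - w) \/
  (s + 2 <= 17 / 10 * X /\ t <= 5 / 4).
Proof.
move=> t1 w0 wy s0 sE h1 h2.
(* combining the hypotheses on X and Y gives t^2 + 3 <= 2 t X *)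
have X_ge k : 2 * t * k <= t ^+ 2 + 3 -> k <= X.
  move=> hk; have : 2 * t * k <= 2 * t * X by clear - hk h1 h2; lra.
  by rewrite ler_pM2l// mulr_gt0//; lra.
have {h1 h2 Y} s_le k : 0 <= k -> s ^+ 2 <= k ^+ 2 -> s <= k.
  by move=> k0; rewrite ler_pXn2r// nnegrE.
have w1 : w <= 1.
  by rewrite -(@ler_pXn2r _ 2)// ?nnegrE// expr1n; have := sqr_ge0 y; lra.
have {wy}yE : y ^+ 2 = 1 - w ^+ 2 by lra.
rewrite {}yE in sE.
have [x4|x4] := ltP (t - w) (1 / 4).
  right; have t54 : t <= 5 / 4 by lra.
  split=> //.
  have : s <= 1031 / 1000.
    apply: s_le; first lra.
    rewrite sE; clear -w0 w1 t1 x4; nra.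
  have : 1783 / 1000 <= X.
    apply: X_ge.
    have : 0 <= (5 / 4 - t) * (t - 1) by apply: mulr_ge0; lra.
    clear -t1 t54; nra.
  lra.
have [sx|sx] := leP s (17 / 10 * (t - w)); [by left|right].
have {sx} key : 189 / 100 * (t - w) ^+ 2 < 1 - w ^+ 2.
  have : (17 / 10 * (t - w)) ^+ 2 < s ^+ 2.
    by rewrite ltr_pXn2r// nnegrE; lra.
  rewrite sE; lra.
(* The pairs (t, w) satisfying key fill an ellipse.  The bounds t_le and w_ge
   come from tangents of it: the vertical one, and the one at t = 1.1; the
   squares in the proofs are the second order remainders. *)
have t_le : t <= 1237 / 1000.
  have := sqr_ge0 (w - 809 / 1000); have := sqr_ge0 (t - w - 428 / 1000).
  clear -key w0 w1; lra.
split; last lra.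
have w_ge : 45 / 100 + 1578 / 1000 * (t - 11 / 10) <= w.
  have := sqr_ge0 (w - 45 / 100); have := sqr_ge0 (t - w - 65 / 100).
  clear -key t1; lra.
have s2_le : s ^+ 2 <= t ^+ 2 + 1 - 2 * t * (45 / 100 + 1578 / 1000 * (t - 11 / 10)).
  have : 0 <= t * (w - (45 / 100 + 1578 / 1000 * (t - 11 / 10))).
    by apply: mulr_ge0; lra.
  rewrite sE; lra.
(* s2_le bounds s by a decreasing function of t, X_ge bounds X by another one *)
have [t112|t112] := leP t (112 / 100).
  have : 1899 / 1000 <= X by apply: X_ge; clear -t1 t112; nra.
  have : s <= 12 / 10 by apply: s_le; [lra|clear -s2_le t1 t112; nra].
  lra.
have : 183 / 100 <= X by apply: X_ge; clear -t1 t_le; nra.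
have : s <= 11 / 10 by apply: s_le; [lra|clear -s2_le t_le t112; nra].
lra.
Qed.

End HopEstimate.

Section Greedy.
Context {R : realType} (F : set (set (R * R))).
Hypotheses (F_cov : disc_covering F) (F_fin : loc_finite F).
Implicit Types (b c p q u x : R * R) (r t : R).

(** The coordinates of q in the orthonormal frame at c whose first vector is
    the unit vector u. *)
Definition along c u q : R := (q.1 - c.1) * u.1 + (q.2 - c.2) * u.2.
Definition across c u q : R := (q.2 - c.2) * u.1 - (q.1 - c.1) * u.2.

Lemma sqr_norm_rotate u (x y : R) : u.1 ^+ 2 + u.2 ^+ 2 = 1 ->
  x ^+ 2 + y ^+ 2 = (x * u.1 + y * u.2) ^+ 2 + (y * u.1 - x * u.2) ^+ 2.
Proof. by move=> u1; rewrite -[LHS]mulr1 -u1; ring. Qed.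

Lemma sqr_dist_along c u q t : u.1 ^+ 2 + u.2 ^+ 2 = 1 ->
  eucl_dist q (c.1 + t * u.1, c.2 + t * u.2) ^+ 2 =
    (along c u q - t) ^+ 2 + across c u q ^+ 2.
Proof.
move=> u1; rewrite sqr_eucl_dist (sqr_norm_rotate _ _ u1) /along /across/=.
congr (_ ^+ 2 + _ ^+ 2); last ring.
by rewrite -[in RHS](mulr1 t) -u1; ring.
Qed.

(** For a centre q, the sum of along c u q and half q is the last time t at
    which the disc around c + t u contains q.  The centre c1 maximizes it among
    the centres at distance at most 2 from c, and t is this maximum.  For every
    e > 0 the disc around c + (t + e) u contains a centre, which must then be
    farther than 2 from c; [centres_gap] makes e tend to 0. *)
Lemma sliding_disc c u : centres F c -> u.1 ^+ 2 + u.2 ^+ 2 = 1 ->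
  exists t c1 c2 w,
    [/\ [/\ centres F c1, centres F c2, 1 <= t & 0 <= w],
        [/\ along c u c1 = t - w, w ^+ 2 + across c u c1 ^+ 2 = 1 &
            eucl_dist c c1 <= 2],
        (along c u c2 - t) ^+ 2 + across c u c2 ^+ 2 <= 1,
        2 <= eucl_dist c c2 &
        eucl_dist c1 c2 <= 2].
Proof.
move=> Cc u1.
have distE q t : (eucl_dist q (c.1 + t * u.1, c.2 + t * u.2)) ^+ 2 =
    (along c u q - t) ^+ 2 + across c u q ^+ 2.
  exact: sqr_dist_along.
pose S := [set q | centres F q /\ eucl_dist q c <= 2] `&`
          [set q | `|across c u q| <= 1].
have Sfin : finite_set S by apply: finite_setIl; exact: finite_centres.
pose half q := Num.sqrt (1 - across c u q ^+ 2).
have Sc : S c.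
  split=> /=; first by rewrite eucl_distxx.
  by rewrite /across !subrr !mul0r subrr normr0.
have [c1 [[Cc1 c1c] /= c1u] c1max] :=
  finite_set_argmax (fun q => along c u q + half q) Sfin Sc.
have t1 := c1max c Sc.
pose t := along c u c1 + half c1; rewrite -/t in t1 c1max.
have halfE q : `|across c u q| <= 1 -> half q ^+ 2 = 1 - across c u q ^+ 2.
  move=> hq; rewrite sqr_sqrtr// subr_ge0.
  by rewrite -(real_normK (num_real _)); have := normr_ge0 (across c u q); nra.
have t_ge1 : 1 <= t.
  move: t1; rewrite /half /along /across !subrr !mul0r subrr addr0 expr0n/=.
  by rewrite subr0 sqrtr1 add0r.
pose p : R * R := (c.1 + t * u.1, c.2 + t * u.2).
have [c2 [Cc2 c2p cc2]] : exists c2, [/\ centres F c2, eucl_dist c2 p <= 1 &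
    2 <= eucl_dist c c2].
  have [e e0 gap] := centres_gap F_fin p.
  pose z : R * R := (c.1 + (t + e) * u.1, c.2 + (t + e) * u.2).
  have [q Cq qz] := covered F_cov z.
  exists q; split=> //.
    apply: gap => //; apply: le_trans (eucl_dist_triangle z _ _) _.
    rewrite lerD// eucl_dist_le ?(ltW e0)// /z/=.
    rewrite (_ : _ + _ = e ^+ 2 * (u.1 ^+ 2 + u.2 ^+ 2)); last ring.
    by rewrite u1 mulr1.
  rewrite leNgt; apply/negP => cq.
  have qz2 : (along c u q - (t + e)) ^+ 2 + across c u q ^+ 2 <= 1.
    by rewrite -distE expr_le1// eucl_dist_ge0.
  have qu : `|across c u q| <= 1.
    rewrite -(@expr_le1 _ 2)// real_normK ?num_real//.
    by have := sqr_ge0 (along c u q - (t + e)); lra.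
  have Sq : S q by do 2 split=> //=; rewrite eucl_distC ltW.
  have := c1max q Sq; have := halfE q qu.
  have : 0 <= half q by exact: sqrtr_ge0.
  nra.
exists t, c1, c2, (half c1); split=> //.
- by split=> //; exact: sqrtr_ge0.
- split; [by rewrite /t; lra|by rewrite halfE//; lra|by rewrite eucl_distC].
- by rewrite -distE expr_le1// eucl_dist_ge0.
- apply: le_trans (eucl_dist_triangle p _ _) _.
  rewrite (eucl_distC p) (_ : 2 = 1 + 1)// lerD//.
  have c1p : eucl_dist c1 p ^+ 2 = 1.
    rewrite distE (_ : _ - t = - half c1); last by rewrite /t; ring.
    by rewrite sqrrN halfE// subrK.
  by rewrite -(@expr_le1 _ 2)// ?eucl_dist_ge0// c1p.
Qed.

(** The decrease of the squared distance serves near b, where the sideways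
    displacement cannot be neglected.  Since the displacement is at most 1, it
    costs at most 1 / (2 (D - x)) < 1 / 190 after a progress of x from distance
    D >= 100, which accounts for the change from 1.7 to 1.74. *)
Lemma greedy_step c b : centres F c -> 2 < eucl_dist c b ->
  exists c1 c2,
    [/\ centres F c1 /\ centres F c2,
        eucl_dist c c1 <= 2 /\ eucl_dist c1 c2 <= 2,
        eucl_dist c2 b ^+ 2 <= eucl_dist c b ^+ 2 - 3 / 20 &
        100 <= eucl_dist c b ->
          eucl_dist c2 b <= eucl_dist c b - 1 / 8 /\
          eucl_dist c c1 + eucl_dist c1 c2 <=
            174 / 100 * (eucl_dist c b - eucl_dist c2 b)].
Proof.
move=> Cc; set D := eucl_dist c b => D2.
have D0 : 0 < D by lra.
have DE := sqr_eucl_dist c b; rewrite -/D in DE.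
pose u : R * R := ((b.1 - c.1) / D, (b.2 - c.2) / D).
have u1 : u.1 ^+ 2 + u.2 ^+ 2 = 1.
  rewrite /u/= (_ : _ + _ = ((c.1 - b.1) ^+ 2 + (c.2 - b.2) ^+ 2) / D ^+ 2).
    by rewrite -DE divff// expf_neq0// lt0r_neq0.
  by field; exact: lt0r_neq0.
have bE : b = (c.1 + D * u.1, c.2 + D * u.2).
  rewrite [LHS]surjective_pairing /u /=; congr (_, _); field; exact: lt0r_neq0.
have distbE q : eucl_dist q b ^+ 2 = (D - along c u q) ^+ 2 + across c u q ^+ 2.
  by rewrite {1}bE (sqr_dist_along _ _ _ u1); ring.
have distcE q : eucl_dist c q ^+ 2 = along c u q ^+ 2 + across c u q ^+ 2.
  rewrite eucl_distC -[along _ _ _]subr0 -sqr_dist_along// !mul0r !addr0.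
  by rewrite -surjective_pairing.
have drift (x y s : R) q : along c u q = x -> across c u q = y ->
    y ^+ 2 <= 1 -> 1 / 4 <= x -> x <= 3 -> s <= 17 / 10 * x -> 100 <= D ->
    eucl_dist q b <= D - 1 / 8 /\ s <= 174 / 100 * (D - eucl_dist q b).
  move=> qx qy y1 x4 x3 sx D100.
  have : eucl_dist q b <= D - x + 1 / 190.
    rewrite -(@ler_pXn2r _ 2)// ?nnegrE ?eucl_dist_ge0//; last lra.
    by rewrite distbE qx qy; nra.
  by move=> h; split; lra.
have [t [c1 [c2 [w [[Cc1 Cc2 t1 w0] [c1x c1y cc1] c2p cc2 c12]]]]] :=
  sliding_disc Cc u1.
have s0 := eucl_dist_ge0 c c1.
have sE := distcE c1; rewrite c1x in sE.
have c2far : 4 <= along c u c2 ^+ 2 + across c u c2 ^+ 2.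
  by rewrite -distcE; nra.
have [[sx x4]|[sX t54]] := one_or_two_hops t1 w0 c1y s0 sE c2p c2far.
  exists c1, c1; split=> //; rewrite ?eucl_distxx//.
    by rewrite distbE c1x; nra.
  move=> D100; rewrite addr0; apply: (drift _ _ _ _ c1x erefl) => //; nra.
exists c1, c2; split=> //.
  by rewrite distbE; nra.
by move=> D100; apply: (drift _ _ _ _ erefl erefl) => //; nra.
Qed.

(** Each greedy step lowers the squared distance by 3 / 20 with a chain of
    length at most 4. *)
Lemma near_chain n c b : centres F c -> centres F b ->
  eucl_dist c b ^+ 2 <= 4 + 3 / 20 * n%:R ->
  chain_connected (centres F) c b (4 * n%:R + 2).
Proof.
elim: n c => [|n IH] c Cc Cb cb.
  all: have [cb2|cb2] := leP (eucl_dist c b) 2.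
  1,3: apply: chain_connectedW (chain_connected_hop Cb cb2 (chain_connected_refl _ _)).
  1,2: by rewrite addr0 (le_trans cb2)// lerDr mulr_ge0.
  by exfalso; clear -cb cb2; nra.
have [c1 [c2 [[Cc1 Cc2] [cc1 c12] closer _]]] := greedy_step Cc cb2.
have c2b : chain_connected (centres F) c2 b (4 * n%:R + 2).
  by apply: IH => //; move: cb; rewrite -natr1; lra.
apply: chain_connectedW (chain_connected_hop Cc1 cc1 (chain_connected_hop Cc2 c12 c2b)).
by rewrite -natr1; lra.
Qed.

(** The additive term is the bound of [near_chain] for centres at distance at
    most 100. *)
Lemma short_chain m c b : 10000 <= 4 + 3 / 20 * m%:R :> R ->
  centres F c -> centres F b ->
  chain_connected (centres F) c b (174 / 100 * eucl_dist c b + (4 * m%:R + 2)).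
Proof.
move=> hm Cc Cb.
have cb0 := eucl_dist_ge0 c b.
have [n] : exists n : nat, eucl_dist c b <= 100 + n%:R / 8.
  exists (Num.bound (8 * eucl_dist c b)).
  have : 0 <= 8 * eucl_dist c b by rewrite mulr_ge0.
  by move=> /archi_boundP; lra.
have near c' : centres F c' -> eucl_dist c' b <= 100 ->
    chain_connected (centres F) c' b (174 / 100 * eucl_dist c' b + (4 * m%:R + 2)).
  move=> Cc' c'b; have c'b0 := eucl_dist_ge0 c' b.
  apply: chain_connectedW (near_chain (n := m) Cc' Cb _); first by lra.
  by apply: le_trans hm; clear - c'b c'b0; nra.
elim: n c Cc {cb0} => [|n IH] c Cc cb.
  by apply: near => //; lra.
have [|far] := leP (eucl_dist c b) 100; first exact: near.
have cb2 : 2 < eucl_dist c b by lra.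
have [c1 [c2 [[Cc1 Cc2] [cc1 c12] _ /(_ (ltW far))[closer cheap]]]] := greedy_step Cc cb2.
have c2b := IH c2 Cc2.
apply: chain_connectedW
  (chain_connected_hop Cc1 cc1 (chain_connected_hop Cc2 c12 (c2b _))).
  by lra.
by move: cb; rewrite -natr1; lra.
Qed.

End Greedy.

(** * Lenses and their vertices *)

Section Arcs.
Context {R : realType}.
Implicit Types (c p q x y : R * R) (s t phi psi : R).

Definition polar c s phi : R * R := (c.1 + s * cos phi, c.2 + s * sin phi).

Lemma polarP c x : c <> x -> exists phi,
  [/\ - pi <= phi, phi <= pi & x = polar c (eucl_dist c x) phi].
Proof.
move=> cx; have s0 : 0 < eucl_dist c x.
  by rewrite lt0r eucl_dist_ge0 andbT; apply/eqP => /eucl_dist_eq0.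
have e : (x.1 - c.1) ^+ 2 + (x.2 - c.2) ^+ 2 = eucl_dist c x ^+ 2.
  by rewrite sqr_eucl_dist; ring.
have [phi [phi1 phi2 e1 e2]] := polar_angle s0 e.
exists phi; split=> //.
by rewrite /polar -e1 -e2 !(addrC _ (_ - _)) !subrK -surjective_pairing.
Qed.

Lemma polarD2pi c s phi : polar c s (phi + pi *+ 2) = polar c s phi.
Proof. by rewrite /polar cosD2pi sinD2pi. Qed.

Lemma sqr_dist_polar c s t phi psi :
  eucl_dist (polar c s phi) (polar c t psi) ^+ 2 =
  s ^+ 2 + t ^+ 2 - 2 * s * t * cos (phi - psi).
Proof.
rewrite sqr_eucl_dist cosB /=.
have := cos2Dsin2 phi; have := cos2Dsin2 psi.
move: (cos phi) (sin phi) (cos psi) (sin psi) => a b a' b' h' h.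
rewrite [LHS](_ : _ = s ^+ 2 * (a ^+ 2 + b ^+ 2) + t ^+ 2 * (a' ^+ 2 + b' ^+ 2) -
  2 * s * t * (a * a' + b * b')); first by rewrite h h' !mulr1.
by ring.
Qed.

Lemma dist_polar c s phi : 0 <= s -> eucl_dist c (polar c s phi) = s.
Proof.
move=> s0; apply/eqP; rewrite -(@eqrXn2 _ 2)// ?eucl_dist_ge0//.
rewrite {1}(_ : c = polar c 0 0).
  by rewrite sqr_dist_polar mulr0 !mul0r subr0 expr0n/= add0r.
by rewrite /polar !mul0r !addr0 -surjective_pairing.
Qed.

Lemma dist_circle_le c phi psi :
  eucl_dist (polar c 1 phi) (polar c 1 psi) <= `|phi - psi|.
Proof.
rewrite -(@ler_pXn2r _ 2)// ?nnegrE ?eucl_dist_ge0// sqr_dist_polar.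
by rewrite real_normK ?num_real//; have := cos_ge_quadratic (phi - psi); lra.
Qed.

(** When p is at distance at most 2 from c, the points of the unit circle around
    c that lie in the disc around p form the arc of this half angle, centred in
    the direction of p. *)
Definition half_angle c p : R := acos (eucl_dist c p / 2).

Lemma half_angle_ge0 c p : eucl_dist c p <= 2 -> 0 <= half_angle c p.
Proof. by move=> cp; have := eucl_dist_ge0 c p; move=> ?; apply: acos_ge0; lra. Qed.

Lemma cos_half_angle c p : eucl_dist c p <= 2 ->
  cos (half_angle c p) = eucl_dist c p / 2.
Proof.
by move=> cp; have := eucl_dist_ge0 c p => ?; rewrite acosK// in_itv/=; lra.
Qed.

Lemma half_angle_le c p : eucl_dist c p <= 2 -> half_angle c p <= pi / 2.
Proof.
move=> cp; rewrite leNgt; apply/negP => lt.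
have := cos_half_angle cp; have := eucl_dist_ge0 c p => cp0.
have : cos (half_angle c p) < cos (pi / 2).
  have Api : half_angle c p <= pi by apply: acos_lepi; lra.
  have i1 : half_angle c p \in `[0, pi] by rewrite in_itv/= half_angle_ge0.
  have i2 : pi / 2 \in `[0, (pi : R)].
    by rewrite in_itv/=; have := @pi_ge0 R; lra.
  by rewrite ltr_cos.
by rewrite cos_pihalf; lra.
Qed.

Lemma half_angle_ge c p : eucl_dist c p <= 2 ->
  pi / 2 - pi / 4 * eucl_dist c p <= half_angle c p.
Proof.
move=> cp; have := cos_ge_chord (half_angle_ge0 cp) (half_angle_le cp).
rewrite cos_half_angle//; set A := half_angle c p; have pi0 := @pi_gt0 R.
rewrite -(ler_pM2l (_ : 0 < pi / 2)); last by rewrite divr_gt0.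
rewrite mulrBr mulr1 [X in _ - X]mulrA (_ : pi / 2 * (2 / pi) = 1) ?mul1r; first lra.
by rewrite -[2 / pi]invf_div divff// lt0r_neq0// divr_gt0.
Qed.

(** The common point of the unit circles around p and q on the left when going
    from p to q; the vertex on the right is [left_vertex q p]. *)
Definition left_vertex p q : R * R :=
  let s := eucl_dist p q in let h := Num.sqrt (1 - (s / 2) ^+ 2) in
  ((p.1 + q.1) / 2 - h * (q.2 - p.2) / s, (p.2 + q.2) / 2 + h * (q.1 - p.1) / s).

Lemma left_vertex_polar c p phi : c <> p -> eucl_dist c p <= 2 ->
  p = polar c (eucl_dist c p) phi ->
  left_vertex c p = polar c 1 (phi + half_angle c p).
Proof.
move=> cp_neq cp pE; have s0 := eucl_dist_ge0 c p.
have sn0 : eucl_dist c p != 0 by apply/eqP => /eucl_dist_eq0.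
have sinA : sin (half_angle c p) = Num.sqrt (1 - (eucl_dist c p / 2) ^+ 2).
  by rewrite sin_acos//; lra.
rewrite /left_vertex /polar cosD sinD cos_half_angle// sinA.
move: sn0 {sinA s0 cp cp_neq}; set h := Num.sqrt _; clearbody h.
set s := eucl_dist c p in pE *; clearbody s => sn0.
by rewrite pE /=; congr (_, _); field.
Qed.

Lemma right_vertex_polar c p phi : c <> p -> eucl_dist c p <= 2 ->
  p = polar c (eucl_dist c p) phi ->
  left_vertex p c = polar c 1 (phi - half_angle c p).
Proof.
move=> cp_neq cp pE; have s0 := eucl_dist_ge0 c p.
have sn0 : eucl_dist c p != 0 by apply/eqP => /eucl_dist_eq0.
have sinA : sin (half_angle c p) = Num.sqrt (1 - (eucl_dist c p / 2) ^+ 2).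
  by rewrite sin_acos//; lra.
rewrite /left_vertex /polar cosB sinB cos_half_angle// sinA (eucl_distC p c).
move: sn0 {sinA s0 cp cp_neq}; set h := Num.sqrt _; clearbody h.
set s := eucl_dist c p in pE *; clearbody s => sn0.
by rewrite pE /=; congr (_, _); field.
Qed.

Lemma dist_polar_le1 c p phi psi : eucl_dist c p <= 2 ->
  p = polar c (eucl_dist c p) phi -> `|phi - psi| <= half_angle c p ->
  eucl_dist p (polar c 1 psi) <= 1.
Proof.
move=> cp pE hA; have s0 := eucl_dist_ge0 c p.
rewrite {1}pE -(@expr_le1 _ 2)// ?eucl_dist_ge0// sqr_dist_polar.
have : cos (half_angle c p) <= cos (phi - psi).
  have Api := half_angle_le cp; have pi0 := @pi_ge0 R.
  have i1 : half_angle c p \in `[0, pi].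
    by rewrite in_itv/= half_angle_ge0//=; lra.
  have i2 : `|phi - psi| \in `[0, (pi : R)].
    by rewrite in_itv/= normr_ge0/=; lra.
  by rewrite -(cos_norm (phi - psi)) leNgt ltr_cos// -leNgt.
rewrite cos_half_angle//; nra.
Qed.

(** If the arcs of the circle around c inside the discs around p and q had a
    common point, p and q would be at distance at most 2. *)
Lemma half_angles_disjoint c p q phi psi :
  eucl_dist c p <= 2 -> eucl_dist c q <= 2 -> 2 < eucl_dist p q ->
  p = polar c (eucl_dist c p) phi -> q = polar c (eucl_dist c q) psi ->
  psi <= phi -> half_angle c p + half_angle c q <= phi - psi.
Proof.
move=> cp cq pq pE qE le; rewrite leNgt; apply/negP => lt.
have A0 := half_angle_ge0 cp; have B0 := half_angle_ge0 cq.
(* the direction of a common point of the two arcs *)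
pose th := Num.max psi (phi - half_angle c p).
have [h1 h2] : psi <= th /\ phi - half_angle c p <= th.
  by rewrite /th !le_max !lexx orbT.
have [h3 h4] : th <= phi /\ th <= psi + half_angle c q.
  by rewrite /th !ge_max; split; apply/andP; split; lra.
have hp := @dist_polar_le1 c p phi th cp pE.
have hq := @dist_polar_le1 c q psi th cq qE.
have := eucl_dist_triangle (polar c 1 th) p q; rewrite (eucl_distC (polar c 1 th) q).
have {}hp : eucl_dist p (polar c 1 th) <= 1 by apply: hp; rewrite ger0_norm; lra.
have {}hq : eucl_dist q (polar c 1 th) <= 1 by apply: hq; rewrite ler0_norm; lra.
lra.
Qed.

End Arcs.

(** * Routes through the doubly covered region *)

Section Routes.
Context {R : realType} (F : set (set (R * R))).
Hypotheses (F_cov : disc_covering F) (F_fin : loc_finite F).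
Implicit Types (a b c p q x : R * R) (s : seq (R * R)) (l r phi psi : R).
Local Notation dc_path := (arclength_path (doubly_covered F)).

Lemma arc_path c phi psi : centres F c -> phi <= psi ->
  dc_path (polar c 1 phi) (polar c 1 psi) (psi - phi).
Proof.
move=> Cc le; split; first by rewrite subr_ge0.
exists (fun t => polar c 1 (phi + t)); split.
- by rewrite addr0.
- by congr polar; ring.
- by move=> t _; apply: (circle_doubly_covered F_cov F_fin Cc); rewrite dist_polar.
- move=> s t s0 st tl; apply: le_trans (dist_circle_le _ _ _) _.
  by rewrite ler0_norm; lra.
Qed.

Lemma circle_path c p q : centres F c -> eucl_dist c p = 1 -> eucl_dist c q = 1 ->
  exists2 l, dc_path p q l & l <= 2 * pi.
Proof.
move=> Cc cp cq.
have neq x : eucl_dist c x = 1 -> c <> x.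
  by move=> cx e; rewrite e eucl_distxx in cx; lra.
have [phi [phi1 phi2]] := polarP (neq _ cp); rewrite cp => ->.
have [psi [psi1 psi2]] := polarP (neq _ cq); rewrite cq => ->.
have [le|/ltW le] := leP phi psi.
  by exists (psi - phi); [exact: arc_path|lra].
by exists (phi - psi); [apply/arclength_path_sym/arc_path|lra].
Qed.

(** With a at angle phi and b at angle psi as seen from c, where
    psi <= phi <= psi + 2 pi, the arc of the left route leads from
    psi + half_angle c b to phi - half_angle c a and the arc of the right route
    from phi + half_angle c a to psi + 2 pi - half_angle c b.  Both have
    nonnegative length by [half_angles_disjoint], and phi and psi cancel in
    the sum. *)
Lemma arcs_around a c b : centres F c -> a <> c -> c <> b ->
  eucl_dist a c <= 2 -> eucl_dist c b <= 2 -> 2 < eucl_dist a b ->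
  exists l r,
    [/\ dc_path (left_vertex a c) (left_vertex c b) l,
        dc_path (left_vertex c a) (left_vertex b c) r &
        l + r <= pi / 2 * (eucl_dist a c + eucl_dist c b)].
Proof.
move=> Cc /nesym ca cb_neq; rewrite (eucl_distC a c) => ca2 cb2 ab2.
have pi0 := @pi_ge0 R.
have [phi0 [phi01 phi02 aE0]] := polarP ca.
have [psi [psi1 psi2 bE]] := polarP cb_neq.
have [phi [le1 le2 aE]] : exists phi, [/\ psi <= phi, phi <= psi + pi *+ 2 &
    a = polar c (eucl_dist c a) phi].
  have [le|lt] := leP psi phi0; [exists phi0|exists (phi0 + pi *+ 2)].
    by split=> //; rewrite mulr2n; lra.
  by rewrite polarD2pi; split=> //; rewrite mulr2n; lra.
have bE' : b = polar c (eucl_dist c b) (psi + pi *+ 2) by rewrite polarD2pi.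
have gap1 := half_angles_disjoint ca2 cb2 ab2 aE bE le1.
rewrite eucl_distC in ab2.
have gap2 := half_angles_disjoint cb2 ca2 ab2 bE' aE le2.
have Aca := half_angle_ge ca2; have Acb := half_angle_ge cb2.
rewrite (right_vertex_polar ca ca2 aE) (left_vertex_polar ca ca2 aE).
rewrite (right_vertex_polar cb_neq cb2 bE') (left_vertex_polar cb_neq cb2 bE).
eexists; eexists; split.
- by apply/arclength_path_sym/arc_path => //; lra.
- by apply: arc_path => //; lra.
- by rewrite mulr2n; lra.
Qed.

(** Every distance between consecutive centres enters with coefficient pi / 2
    into [arcs_around] at each of its two ends; at the first centre there is no
    arc, hence the smaller coefficient of the first distance. *)
Lemma two_routes a c s : centres F a -> taut_chain (centres F) a (c :: s) ->
  exists l r p q,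
    [/\ dc_path (left_vertex a c) p l, dc_path (left_vertex c a) q r,
        eucl_dist (last c s) p = 1, eucl_dist (last c s) q = 1 &
        l + r <= pi / 2 * eucl_dist a c + pi * chain_length c s].
Proof.
elim: s a c => [|b s IH] a c Ca [Cc ac ac2].
  move=> _ _; have ca := nesym ac; rewrite eucl_distC in ac2.
  have [phi [_ _ aE]] := polarP ca.
  have e1 := right_vertex_polar ca ac2 aE; have e2 := left_vertex_polar ca ac2 aE.
  have dc1 psi : doubly_covered F (polar c 1 psi).
    by apply: (circle_doubly_covered F_cov F_fin Cc); rewrite dist_polar.
  exists 0, 0, (left_vertex a c), (left_vertex c a).
  rewrite e1 e2 /= !dist_polar//; split=> //; try exact: arclength_path_refl.
  by rewrite mulr0 !addr0 mulr_ge0 ?eucl_dist_ge0// divr_ge0// pi_ge0.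
move=> ab2 cs_taut; have [Cb cb cb2 _ _] := cs_taut.
have [l1 [r1 [path_l1 path_r1 sum1]]] := arcs_around Cc ac cb ac2 cb2 ab2.
have [l2 [r2 [p [q [path_l2 path_r2 bp bq sum2]]]]] := IH c b Cc cs_taut.
exists (l1 + l2), (r1 + r2), p, q; split=> //.
- exact: arclength_path_trans path_l1 path_l2.
- exact: arclength_path_trans path_r1 path_r2.
- by rewrite /=; lra.
Qed.

Lemma chain_path a b x y l : centres F a -> eucl_dist a x = 1 -> eucl_dist b y = 1 ->
  centres F b -> chain_connected (centres F) a b l ->
  exists2 l', dc_path x y l' & l' <= pi / 2 * l + 4 * pi.
Proof.
move=> Ca ax bY Cb [[|c s] [/= s_taut s_last s_len]].
  rewrite -s_last in bY; have [l' path_xy l'_le] := circle_path Ca ax bY.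
  exists l' => //; have : 0 <= pi / 2 * l by rewrite mulr_ge0 ?divr_ge0 ?pi_ge0.
  by have := @pi_ge0 R; lra.
have [l1 [r1 [p [q [path_l path_r bp bq sum]]]]] := two_routes Ca s_taut.
rewrite s_last in bp bq.
have [Cc ac ac2 _ _] := s_taut.
have [phi [_ _ cE]] := polarP ac.
have on_a : eucl_dist a (left_vertex a c) = 1 /\ eucl_dist a (left_vertex c a) = 1.
  by rewrite (left_vertex_polar ac ac2 cE) (right_vertex_polar ac ac2 cE) !dist_polar.
have half_sum : (l1 + r1) / 2 <= pi / 2 * l.
  have : pi / 2 * (eucl_dist a c + chain_length c s) <= pi / 2 * l.
    by rewrite ler_wpM2l// divr_ge0// pi_ge0.
  have : 0 <= pi * eucl_dist a c by rewrite mulr_ge0 ?pi_ge0 ?eucl_dist_ge0.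
  by lra.
have [le|le] := leP l1 r1.
  have [l2 path2 l2_le] := circle_path Ca ax on_a.1.
  have [l3 path3 l3_le] := circle_path Cb bp bY.
  exists (l2 + (l1 + l3)); last by lra.
  exact: arclength_path_trans path2 (arclength_path_trans path_l path3).
have [l2 path2 l2_le] := circle_path Ca ax on_a.2.
have [l3 path3 l3_le] := circle_path Cb bq bY.
exists (l2 + (r1 + l3)); last by lra.
exact: arclength_path_trans path2 (arclength_path_trans path_r path3).
Qed.

Lemma segment_path (U : set (R * R)) x y :
  (forall t : R, 0 <= t <= 1 ->
    U (x.1 + t * (y.1 - x.1), x.2 + t * (y.2 - x.2))) ->
  arclength_path U x y (eucl_dist x y).
Proof.
move=> Useg; have [xy|/eqP xy] := eqVneq x y.
  rewrite -xy eucl_distxx; apply: arclength_path_refl.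
  by have := Useg 0; rewrite !mul0r !addr0 -surjective_pairing; apply; rewrite lexx ler01.
have d0 : 0 < eucl_dist x y.
  by rewrite lt0r eucl_dist_ge0 andbT; apply/eqP => /eucl_dist_eq0.
have dE := sqr_eucl_dist x y; set d := eucl_dist x y in d0 dE *.
split; first exact: ltW.
exists (fun t => (x.1 + t / d * (y.1 - x.1), x.2 + t / d * (y.2 - x.2))); split.
- by rewrite !mul0r !addr0 -surjective_pairing.
- by rewrite divff ?lt0r_neq0// !mul1r ![_ + (_ - _)]addrC !subrK -surjective_pairing.
- move=> t /andP[t0 td]; apply: Useg.
  by rewrite divr_ge0 ?(ltW d0)//= ler_pdivrMr// mul1r.
- move=> s t s0 st td; rewrite eucl_dist_le ?subr_ge0//=.
  rewrite (_ : _ + _ = ((x.1 - y.1) ^+ 2 + (x.2 - y.2) ^+ 2) / d ^+ 2 * (t - s) ^+ 2).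
    by rewrite -dE divff ?mul1r// expf_neq0// lt0r_neq0.
  by field; exact: lt0r_neq0.
Qed.

Lemma convex_unit_disc c x y (t : R) : eucl_dist c x <= 1 -> eucl_dist c y <= 1 ->
  0 <= t <= 1 ->
  eucl_dist c (x.1 + t * (y.1 - x.1), x.2 + t * (y.2 - x.2)) <= 1.
Proof.
rewrite !eucl_dist_le// expr1n /= => cx cy /andP[t0 t1].
pose u := (c.1 - x.1) ^+ 2 + (c.2 - x.2) ^+ 2.
pose v := (c.1 - y.1) ^+ 2 + (c.2 - y.2) ^+ 2.
rewrite (_ : _ + _ = (1 - t) * u + t * v -
   t * (1 - t) * ((x.1 - y.1) ^+ 2 + (x.2 - y.2) ^+ 2)); last by rewrite /u /v; ring.
have : 0 <= t * (1 - t) * ((x.1 - y.1) ^+ 2 + (x.2 - y.2) ^+ 2).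
  have t1' : 0 <= 1 - t by lra.
  by rewrite mulr_ge0// ?(addr_ge0 (sqr_ge0 _) (sqr_ge0 _))// mulr_ge0.
have : (1 - t) * u <= (1 - t) * 1 by rewrite ler_wpM2l//; lra.
have : t * v <= t * 1 by rewrite ler_wpM2l.
lra.
Qed.

(** The point of the circle in the direction of the centre of the second disc
    lies in both discs, and so does the segment to it. *)
Lemma path_to_circle x : doubly_covered F x -> exists c p l,
  [/\ centres F c, eucl_dist c x <= 1, eucl_dist c p = 1, dc_path x p l & l <= 2].
Proof.
move=> [D1 [D2 [FD1 FD2 D12 D1x D2x]]].
have [c _ cD1] := F_cov.1 _ FD1; have [c' _ cD2] := F_cov.1 _ FD2.
rewrite -cD1 -cD2 in FD1 FD2 D12 D1x D2x.
have cc' : c <> c' by move=> e; rewrite e in D12.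
have cx : eucl_dist c x <= 1 by [].
have c'x : eucl_dist c' x <= 1 by [].
have cc'2 : eucl_dist c c' <= 2.
  by have := eucl_dist_triangle x c c'; rewrite (eucl_distC x); lra.
have cc'0 : 0 <= eucl_dist c c' by exact: eucl_dist_ge0.
have [phi [_ _ c'E]] := polarP cc'.
have c'p : eucl_dist c' (polar c 1 phi) <= 1.
  by apply: dist_polar_le1 c'E _ => //; rewrite subrr normr0 half_angle_ge0.
have cp : eucl_dist c (polar c 1 phi) = 1 by rewrite dist_polar.
exists c, (polar c 1 phi), (eucl_dist x (polar c 1 phi)); split=> //.
  apply: segment_path => t t01.
  apply: (lens_doubly_covered FD1 FD2 cc'); apply: convex_unit_disc => //.
  by rewrite cp.
by have := eucl_dist_triangle c x (polar c 1 phi); rewrite (eucl_distC x c); lra.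
Qed.

End Routes.

Theorem theorem1 (R : realType) :
  exists K : R,
    forall F : set (set (R * R)), disc_covering F -> loc_finite F ->
    forall A B : R * R, doubly_covered F A -> doubly_covered F B ->
    exists gamma : R -> R * R,
      path_in (doubly_covered F) A B gamma /\
      (path_length gamma <=
         ((pi / 3 + Num.sqrt 3) * eucl_dist A B + K)%:E)%E.
Proof.
have [m hm] : exists m : nat, 10000 <= 4 + 3 / 20 * m%:R :> R.
  have archimedean (x : R) : 0 <= x -> exists m : nat, x <= m%:R.
    by move=> x0; exists (Num.bound x); exact/ltW/archi_boundP.
  have x0 : 0 <= 20 / 3 * 9996 :> R by lra.
  by have [m hm] := archimedean _ x0; exists m; lra.
exists (pi / 2 * (174 / 100 * 2 + (4 * m%:R + 2)) + 4 * pi + 4).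
move=> F F_cov F_fin A B dcA dcB.
have [a [p [l1 [Ca aA ap path1 l1_le]]]] := path_to_circle F_cov dcA.
have [b [q [l2 [Cb bB bq path2 l2_le]]]] := path_to_circle F_cov dcB.
have ab_chain := short_chain F_cov F_fin hm Ca Cb.
have [l path_pq l_le] := chain_path F_cov F_fin Ca ap bq Cb ab_chain.
have [gamma [gamma_in gamma_len]] := arclength_path_path
  (arclength_path_trans path1 (arclength_path_trans path_pq (arclength_path_sym path2))).
exists gamma; split=> //; apply: le_trans gamma_len _; rewrite lee_fin.
have ab_le : eucl_dist a b <= eucl_dist A B + 2.
  have := eucl_dist_triangle A a b; have := eucl_dist_triangle B A b.
  by rewrite (eucl_distC B b); lra.
have rate : pi / 2 * (174 / 100) <= pi / 3 + Num.sqrt 3 :> R.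
  have : 173 / 100 <= Num.sqrt 3 :> R.
    have := @sqr_sqrtr R 3 (ler0n _ _); have := sqrtr_ge0 (3 : R).
    by move: (Num.sqrt 3) => s s0 sE; nra.
  by have := @pi_le_16_5 R; lra.
have : pi / 2 * (174 / 100) * eucl_dist A B <=
    (pi / 3 + Num.sqrt 3) * eucl_dist A B by rewrite ler_wpM2r// eucl_dist_ge0.
have : pi / 2 * (174 / 100) * eucl_dist a b <=
    pi / 2 * (174 / 100) * (eucl_dist A B + 2).
  by rewrite ler_wpM2l// !mulr_ge0 ?divr_ge0 ?pi_ge0//; lra.
lra.
Qed.
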